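(* Let $T$ be the free model monad of an algebraic theory $\mathbb{T}=(\Sigma_{\mathbb{T}},E_{\mathbb{T}})$ such that $E_{\mathbb{T}}$ contains no drop equations. Then parallel lifting defines a distributive law of monads $T_{\mathsf{sd}}D_{\mathsf{sd}}\to D_{\mathsf{sd}}T_{\mathsf{sd}}$ on the category of setoids.
   Context: An equation $s=t$ is a drop equation if $s$ and $t$ do not have the same set of variables. $D$ is the coinductive delay monad: $DX\simeq X+DX$ final coalgebra with $\mathsf{now}$, $\mathsf{step}$ (in Clocked Cubical Type Theory $DX=\forall\kappa.D^\kappa X$). For a relation $R$ on $X$, weak bisimilarity $\approx_R$ on $DX$ is defined coinductively: $\mathsf{now}(x)\approx_R y$ iff $y=\mathsf{step}^n(\mathsf{now}\,y')$ for some $n\in\mathbb{N}$ and $y'$ with $R(x,y')$; $x\approx_R\mathsf{now}(y)$ iff $x=\mathsf{step}^n(\mathsf{now}\,x')$ with $R(x',y)$; $\mathsf{step}(x)\approx_R\mathsf{step}(y)$ iff $x\approx_R y$. The category of setoids has objects $(X,R)$ with $R$ an equivalence relation on the set $X$, and morphisms equivalence classes of relation-preserving maps, two maps being equivalent if they send related inputs to related outputs. $D_{\mathsf{sd}}(X,R)=(DX,\approx_R)$ is a monad on setoids (with the unit and multiplication of $D$). $T_{\mathsf{sd}}(X,R)=(TX,T(R))$ where $T(R)$ is the smallest equivalence relation relating $[t(x_1,\dots,x_n)]$ and $[t(y_1,\dots,y_n)]$ whenever $R(x_i,y_i)$ for all $i$. For a $T$-model $X$ and $n$-ary operation $\diamond$,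 the parallel lifting $\diamond^{\mathsf{par}}$ on $DX$ is defined corecursively: $\diamond^{\mathsf{par}}(\mathsf{now}\,x_1,\dots,\mathsf{now}\,x_n)=\mathsf{now}(\diamond_X(x_1,\dots,x_n))$, and if some argument is a $\mathsf{step}$, $\diamond^{\mathsf{par}}(x_1,\dots,x_n)=\mathsf{step}(\diamond^{\mathsf{par}}(x_1',\dots,x_n'))$ with $x_i'=x_i$ if $x_i=\mathsf{now}(\cdot)$ and $x_i'=z$ if $x_i=\mathsf{step}(z)$. For theories with no drop equations these liftings satisfy the equations, making $D(TX)$ a $T$-model, and the induced natural transformation $TDX\to DTX$ is the unique $T$-homomorphism extending $D\eta^T:DX\to DTX$. A distributive law $\zeta:ST\to TS$ of monads satisfies $\zeta\circ\eta^S T=T\eta^S$, $\zeta\circ S\eta^T=\eta^T S$, $\zeta\circ\mu^S T=T\mu^S\circ\zeta S\circ S\zeta$, $\zeta\circ S\mu^T=\mu^T S\circ T\zeta\circ\zeta T$. *)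

(* Defs.v *)
From HB Require Import structures.
From Stdlib Require Import RelationClasses Relation_Operators.
From mathcomp Require Import all_boot boolp.

Set Implicit Arguments.
Unset Strict Implicit.
Unset Printing Implicit Defensive.

Local Open Scope quotient_scope.

Definition asbool_rel (T : Type) (R : T -> T -> Prop) : rel {classic T} :=
  fun x y => `[< R x y >].

Lemma asbool_rel_refl (T : Type) (R : T -> T -> Prop) (E : Equivalence R) :
  reflexive (asbool_rel R).
Proof. by move=> x; apply/asboolP; case: E. Qed.

Lemma asbool_rel_sym (T : Type) (R : T -> T -> Prop) (E : Equivalence R) :
  symmetric (asbool_rel R).
Proof.
by move=> x y; apply/asboolP/asboolP; case: E => _ s _; apply: s.
Qed.

Lemma asbool_rel_trans (T : Type) (R : T -> T -> Prop) (E : Equivalence R) :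
  transitive (asbool_rel R).
Proof.
move=> y x z /asboolP xy /asboolP yz; apply/asboolP.
by case: E => _ _ t; apply: t xy yz.
Qed.

Definition equiv_rel_of (T : Type) (R : T -> T -> Prop) (E : Equivalence R) :
    equiv_rel {classic T} :=
  EquivRel (asbool_rel R) (asbool_rel_refl E) (asbool_rel_sym E)
           (asbool_rel_trans E).

Definition quot (T : Type) (R : T -> T -> Prop) (E : Equivalence R) : Type :=
  {eq_quot (equiv_rel_of E)}.

Definition cls (T : Type) (R : T -> T -> Prop) (E : Equivalence R) (x : T) :
  quot E := \pi_{eq_quot (equiv_rel_of E)} x.

Definition rep (T : Type) (R : T -> T -> Prop) (E : Equivalence R)
  (q : quot E) : T := @generic_quotient.repr _ {eq_quot (equiv_rel_of E)} q.

Lemma clsP (T : Type) (R : T -> T -> Prop) (E : Equivalence R) (x y : T) :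
  cls E x = cls E y <-> R x y.
Proof.
split; first by move/(@eqmodP _ (equiv_rel_of E))/asboolP.
by move=> h; apply/(@eqmodP _ (equiv_rel_of E)); apply/asboolP.
Qed.

Lemma repK (T : Type) (R : T -> T -> Prop) (E : Equivalence R) (q : quot E) :
  cls E (rep q) = q.
Proof. exact: (@reprK _ {eq_quot (equiv_rel_of E)}). Qed.

Lemma rep_cls (T : Type) (R : T -> T -> Prop) (E : Equivalence R) (x : T) :
  R (rep (cls E x)) x.
Proof. by apply/(clsP E); rewrite repK. Qed.

(* A CoInductive type with constructors now and step is not a final coalgebra
   up to Leibniz equality.  The set of sequences [nat -> option X] that stay
   constant once defined is one: see [coitE] and [coit_uniq]; [tr d n = Some x]
   means that [d] returns [x] after at most [n] steps. *)
Record delay (X : Type) : Type := Delay {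
  tr :> nat -> option X;
  tr_mono : forall n x, tr n = Some x -> tr n.+1 = Some x }.

Lemma delay_eq (X : Type) (d e : delay X) : (forall n, d n = e n) -> d = e.
Proof.
case: d e => [d dm] [e em] /= de.
have {}de : d = e by apply/funext.
by rewrite -{}de in em *; congr Delay; apply: Prop_irrelevance.
Qed.

Definition now (X : Type) (x : X) : delay X :=
  @Delay X (fun=> Some x) (fun _ _ h => h).

Definition step_tr (X : Type) (d : delay X) (n : nat) : option X :=
  if n is m.+1 then d m else None.

Lemma step_tr_mono (X : Type) (d : delay X) n x :
  step_tr d n = Some x -> step_tr d n.+1 = Some x.
Proof. by case: n => //= n; apply: tr_mono. Qed.

Definition step (X : Type) (d : delay X) : delay X := Delay (@step_tr_mono X d).

Definition tail (X : Type) (d : delay X) : delay X :=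
  @Delay X (fun n => d n.+1) (fun n x => @tr_mono X d n.+1 x).

Definition out (X : Type) (d : delay X) : X + delay X :=
  if d 0 is Some x then inl x else inr (tail d).

Definition inn (X : Type) (s : X + delay X) : delay X :=
  match s with inl x => now x | inr d => step d end.

Lemma tr0_const (X : Type) (d : delay X) x n : d 0 = Some x -> d n = Some x.
Proof. by move=> d0; elim: n => // n; apply: tr_mono. Qed.

Lemma outK (X : Type) : cancel (@out X) (@inn X).
Proof.
move=> d; apply: delay_eq => n; rewrite /out.
case d0: (d 0) => [x|]; first by rewrite /= (tr0_const n d0).
by case: n.
Qed.

Lemma innK (X : Type) : cancel (@inn X) (@out X).
Proof. by case=> // d; rewrite /out /=; congr inr; apply: delay_eq. Qed.

Fixpoint coit_tr (X S : Type) (c : S -> X + S) (n : nat) (s : S) : option X :=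
  match c s with
  | inl x => Some x
  | inr s' => if n is m.+1 then coit_tr c m s' else None
  end.

Lemma coit_tr_mono (X S : Type) (c : S -> X + S) (s : S) n x :
  coit_tr c n s = Some x -> coit_tr c n.+1 s = Some x.
Proof.
elim: n s => [|n IHn] s; first by move=> /=; case: (c s).
rewrite /= -/(coit_tr c); case: (c s) => // s' /IHn; exact.
Qed.

Definition coit (X S : Type) (c : S -> X + S) (s : S) : delay X :=
  Delay (@coit_tr_mono X S c s).

Lemma coitE (X S : Type) (c : S -> X + S) (s : S) :
  out (coit c s) =
  match c s with inl x => inl x | inr s' => inr (coit c s') end.
Proof.
rewrite /out /=; case e: (c s) => [//|s']; congr inr.
by apply: delay_eq => n /=; rewrite e.
Qed.

Lemma coit_uniq (X S : Type) (c : S -> X + S) (h : S -> delay X) :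
  (forall s, out (h s) =
     match c s with inl x => inl x | inr s' => inr (h s') end) ->
  forall s, h s = coit c s.
Proof.
move=> hE s; apply: delay_eq => n; change (h s n = coit_tr c n s).
elim: n s => [|n IHn] s; rewrite -[h s]outK hE /=; case: (c s) => //= s'.
Qed.

Definition dmap (X Y : Type) (f : X -> Y) : delay X -> delay Y :=
  coit (fun d => match out d with inl x => inl (f x) | inr e => inr e end).

Lemma dmap_now (X Y : Type) (f : X -> Y) x : dmap f (now x) = now (f x).
Proof. by rewrite -[LHS]outK /dmap coitE. Qed.

Lemma dmap_step (X Y : Type) (f : X -> Y) d :
  dmap f (step d) = step (dmap f d).
Proof. by rewrite -[LHS]outK /dmap coitE -/(inn (inr d)) innK. Qed.

(* Coiteration from state [now d] behaves as [d]. *)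
Definition djoin (X : Type) : delay (delay X) -> delay X :=
  coit (fun dd => match out dd with
    | inr ee => inr ee
    | inl d => match out d with inl x => inl x | inr e => inr (now e) end
    end).

Lemma djoin_now (X : Type) (d : delay X) : djoin (now d) = d.
Proof.
have H : forall e : delay X, djoin (now e) =
    coit (fun d => match out d with inl x => inl x | inr e => inr e end) e.
  apply: coit_uniq => e; rewrite /djoin coitE -/(inn (inl e)) innK.
  by case: (out e).
rewrite H; symmetry; apply: (coit_uniq (h := id)) => e.
by case: (out e).
Qed.

Lemma djoin_step (X : Type) (dd : delay (delay X)) :
  djoin (step dd) = step (djoin dd).
Proof. by rewrite -[LHS]outK /djoin coitE -/(inn (inr dd)) innK. Qed.

CoInductive wbisim (X : Type) (R : X -> X -> Prop) :
    delay X -> delay X -> Prop :=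
| wbisim_nowl x n y' :
    R x y' -> wbisim R (now x) (iter n (@step X) (now y'))
| wbisim_nowr n x' y :
    R x' y -> wbisim R (iter n (@step X) (now x')) (now y)
| wbisim_step x y : wbisim R x y -> wbisim R (step x) (step y).

Definition conv (X : Type) (d : delay X) (x : X) : Prop :=
  exists n, d n = Some x.

Lemma tr_leq (X : Type) (d : delay X) n m x :
  n <= m -> d n = Some x -> d m = Some x.
Proof. by move=> /subnK <- dn; elim: (m - n) => // k; apply: tr_mono. Qed.

Lemma conv_fun (X : Type) (d : delay X) x y : conv d x -> conv d y -> x = y.
Proof.
move=> [n dn] [m dm]; apply: Some_inj.
by rewrite -(tr_leq (leq_maxl n m) dn) (tr_leq (leq_maxr n m) dm).
Qed.

Lemma conv_now (X : Type) (x y : X) : conv (now x) y <-> y = x.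
Proof. by split=> [[n [->]]|->] //; exists 0. Qed.

Lemma conv_step (X : Type) (d : delay X) y : conv (step d) y <-> conv d y.
Proof.
split=> [[[|n] // dn]|[n dn]]; first by exists n.
by exists n.+1.
Qed.

Lemma conv_iter (X : Type) n (x y : X) :
  conv (iter n (@step X) (now x)) y <-> y = x.
Proof.
elim: n => [|n IHn]; first exact: conv_now.
by rewrite iterS conv_step.
Qed.

Lemma conv_iterE (X : Type) (d : delay X) x :
  conv d x -> exists n, d = iter n (@step X) (now x).
Proof.
case=> n; elim: n d => [|n IHn] d dn.
  by exists 0; apply: delay_eq => n; rewrite (tr0_const n dn).
rewrite -[d]outK /out; case d0: (d 0) => [y|] /=.
  by exists 0; congr now; apply: Some_inj; rewrite -dn (tr0_const _ d0).
by have [m ->] := IHn (tail d) dn; exists m.+1.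
Qed.

Lemma wbisim_coind (X : Type) (R : X -> X -> Prop)
    (S : delay X -> delay X -> Prop) :
  (forall d e, S d e ->
     [\/ exists x n y, [/\ d = now x, e = iter n (@step X) (now y) & R x y],
         exists n x y, [/\ d = iter n (@step X) (now x), e = now y & R x y]
       | exists d' e', [/\ d = step d', e = step e' & S d' e']]) ->
  forall d e, S d e -> wbisim R d e.
Proof.
move=> HS; cofix CH => d e /HS.
case=> [[x [n [y [dE eE h]]]]|[n [x [y [dE eE h]]]]|[d' [e' [dE eE h]]]].
- by rewrite dE eE; apply: wbisim_nowl.
- by rewrite dE eE; apply: wbisim_nowr.
- rewrite dE eE; apply: wbisim_step; exact: CH.
Qed.

Lemma wbisim_convl (X : Type) (R : X -> X -> Prop) (d e : delay X) x :
  wbisim R d e -> conv d x -> exists2 y, conv e y & R x y.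
Proof.
move=> de [n]; elim: n d e de => [|n IHn] d e de.
  case: d e / de => [x' n y' h|n x' y' h|//].
    by move=> /(ex_intro (fun k => now x' k = Some x) 0)/conv_now ->;
       exists y' => //; apply/conv_iter.
  move=> /(ex_intro (fun k => iter n (@step X) (now x') k = Some x) 0).
  by move=> /conv_iter ->; exists y' => //; apply/conv_now.
case: d e / de => [x' k y' h|k x' y' h|d e de].
- by move=> /(ex_intro (fun k => now x' k = Some x) n.+1)/conv_now ->;
    exists y' => //; apply/conv_iter.
- move=> /(ex_intro (fun i => iter k (@step X) (now x') i = Some x) n.+1).
  by move=> /conv_iter ->; exists y' => //; apply/conv_now.
- by move=> /= /(IHn _ _ de)[y ey h]; exists y => //; apply/conv_step.
Qed.

Lemma wbisim_flip (X : Type) (R S : X -> X -> Prop) (d e : delay X) :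
  (forall x y, R x y -> S y x) -> wbisim R d e -> wbisim S e d.
Proof.
move=> RS de.
apply: (@wbisim_coind X S (fun d e => wbisim R e d)) de => {}d {}e de.
case: _ _ / de => [x n y h|n x y h|{}d {}e de].
- by apply: Or32; exists n, y, x; split=> //; apply: RS.
- by apply: Or31; exists y, n, x; split=> //; apply: RS.
- by apply: Or33; exists e, d.
Qed.

Lemma wbisimP (X : Type) (R : X -> X -> Prop) (d e : delay X) :
  wbisim R d e <->
  (forall x, conv d x -> exists2 y, conv e y & R x y) /\
  (forall y, conv e y -> exists2 x, conv d x & R x y).
Proof.
split=> [de|].
  split=> [x|y]; first exact: wbisim_convl.
  exact: (wbisim_convl (wbisim_flip (S := fun x y => R y x) (fun _ _ => id) de)).
move: d e; apply: wbisim_coind => d e [l r].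
case dE: (out d) => [x|d'].
  have {}dE : d = now x by rewrite -[d]outK dE.
  apply: Or31; rewrite dE in l *.
  have [y ey h] := l x (proj2 (conv_now x x) erefl).
  have [n eE] := conv_iterE ey.
  by exists x, n, y.
case eE: (out e) => [y|e'].
  have {}eE : e = now y by rewrite -[e]outK eE.
  apply: Or32; rewrite eE in r *.
  have [x dx h] := r y (proj2 (conv_now y y) erefl).
  have [n ->] := conv_iterE dx.
  by exists n, x, y.
have {}dE : d = step d' by rewrite -[d]outK dE.
have {}eE : e = step e' by rewrite -[e]outK eE.
apply: Or33; exists d', e'; rewrite dE eE in l r *; split=> //; split=> [x|y].
  by move=> /conv_step/l[y /conv_step ey h]; exists y.
by move=> /conv_step/r[x /conv_step dx h]; exists x.
Qed.

Lemma wbisim_equiv (X : Type) (R : X -> X -> Prop) :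
  Equivalence R -> Equivalence (wbisim R).
Proof.
case=> Rr Rs Rt; split=> [d|d e|d e f].
- by apply/wbisimP; split=> x ?; exists x.
- exact: wbisim_flip.
- move=> /wbisimP[l1 r1] /wbisimP[l2 r2]; apply/wbisimP; split=> [x|x].
    by move=> /l1[y /l2[z fz yz] xy]; exists z => //; apply: Rt xy yz.
  by move=> /r2[y /r1[z fz yz] xy]; exists z => //; apply: Rt yz xy.
Qed.

Lemma conv_dmap (X Y : Type) (f : X -> Y) (d : delay X) y :
  conv (dmap f d) y <-> exists2 x, conv d x & y = f x.
Proof.
split=> [[n]|[x dx ->]]; last first.
  have [n ->] := conv_iterE dx.
  elim: n => [|n IHn] /=; first by rewrite dmap_now; apply/conv_now.
  by rewrite dmap_step; apply/conv_step.
elim: n d => [|n IHn] d; rewrite -[d]outK; case: (out d) => [x|e];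
  rewrite /inn ?dmap_now ?dmap_step //.
- by case=> <-; exists x => //; apply/conv_now.
- by case=> <-; exists x => //; apply/conv_now.
- by move=> /IHn[x ex ->]; exists x => //; apply/conv_step.
Qed.

Lemma conv_djoin (X : Type) (dd : delay (delay X)) x :
  conv (djoin dd) x <-> exists2 d, conv dd d & conv d x.
Proof.
split=> [[n]|[d ddd dx]]; last first.
  have [n ->] := conv_iterE ddd.
  elim: n => [|n IHn] /=; first by rewrite djoin_now.
  by rewrite djoin_step; apply/conv_step.
elim: n dd => [|n IHn] dd; rewrite -[dd]outK; case: (out dd) => [d|e];
  rewrite /inn ?djoin_now ?djoin_step //.
- by move=> dn; exists d; first exact/conv_now; exists 0.
- by move=> dn; exists d; first exact/conv_now; exists n.+1.
- by move=> /IHn[d ed dx]; exists d => //; apply/conv_step.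
Qed.

Record signature : Type := Signature {
  operation :> Type;
  arity : operation -> nat }.

Inductive term (S : signature) (X : Type) : Type :=
| Var of X
| Op (o : S) of ('I_(arity o) -> term S X).

Arguments Var {S X} _.
Arguments Op {S X} o _.

Fixpoint eval (S : signature) (X M : Type)
    (ops : forall o : S, ('I_(arity o) -> M) -> M) (v : X -> M)
    (t : term S X) : M :=
  match t with
  | Var x => v x
  | Op o a => ops o (fun i => eval ops v (a i))
  end.

Definition subst (S : signature) (X Y : Type) (s : X -> term S Y) :
  term S X -> term S Y := eval (@Op S Y) s.

Fixpoint occurs (S : signature) (X : Type) (x : X) (t : term S X) : Prop :=
  match t with
  | Var y => x = y
  | Op o a => exists i, occurs x (a i)
  end.

Record theory : Type := Theory {
  sig :> signature;
  equations : term sig nat -> term sig nat -> Prop }.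

Definition drop_equation (S : signature) (s t : term S nat) : Prop :=
  ~ (forall x, occurs x s <-> occurs x t).

Definition no_drop_equations (Th : theory) : Prop :=
  forall s t, equations (t := Th) s t -> ~ drop_equation s t.

Record model (Th : theory) : Type := Model {
  carrier :> Type;
  interp : forall o : Th, ('I_(arity o) -> carrier) -> carrier;
  interp_sat : forall s t, equations (t := Th) s t ->
    forall v : nat -> carrier, eval interp v s = eval interp v t }.

Arguments interp {Th} m o _.

Definition is_hom (Th : theory) (M N : model Th) (h : M -> N) : Prop :=
  forall o a, h (interp M o a) = interp N o (fun i => h (a i)).

Inductive provable (Th : theory) (X : Type) :
    term Th X -> term Th X -> Prop :=
| provable_ax s t (v : nat -> term Th X) :
    equations (t := Th) s t -> provable (subst v s) (subst v t)
| provable_refl t : provable t t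
| provable_sym s t : provable s t -> provable t s
| provable_trans s t u : provable s t -> provable t u -> provable s u
| provable_cong o a b :
    (forall i, provable (a i) (b i)) -> provable (Op o a) (Op o b).

Lemma provable_equiv (Th : theory) (X : Type) : Equivalence (@provable Th X).
Proof.
split; [exact: provable_refl | exact: provable_sym | exact: provable_trans].
Qed.

Definition free (Th : theory) (X : Type) : Type := quot (@provable_equiv Th X).

Definition tcls (Th : theory) (X : Type) (t : term Th X) : free Th X :=
  cls (@provable_equiv Th X) t.

Definition free_op (Th : theory) (X : Type) (o : Th)
  (a : 'I_(arity o) -> free Th X) : free Th X := tcls (Op o (fun i => rep (a i))).

Lemma free_opE (Th : theory) (X : Type) (o : Th)
    (a : 'I_(arity o) -> term Th X) :
  free_op (fun i => tcls (a i)) = tcls (Op o a).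
Proof. by apply/clsP; apply: provable_cong => i; apply: rep_cls. Qed.

Lemma eval_free (Th : theory) (X Y : Type) (v : Y -> term Th X)
    (t : term Th Y) :
  eval (@free_op Th X) (fun y => tcls (v y)) t = tcls (subst v t).
Proof.
elim: t => [y|o a IH] //=; rewrite -free_opE; congr free_op.
by apply/funext.
Qed.

Lemma free_sat (Th : theory) (X : Type) s t : equations (t := Th) s t ->
  forall v : nat -> free Th X, eval (@free_op Th X) v s = eval (@free_op Th X) v t.
Proof.
move=> st v; have -> : v = fun n => tcls (rep (v n)).
  by apply/funext=> n; rewrite /tcls repK.
by rewrite !eval_free; apply/clsP; apply: provable_ax.
Qed.

Definition free_model (Th : theory) (X : Type) : model Th :=
  Model (@free_sat Th X).

Definition free_eta (Th : theory) (X : Type) (x : X) : free Th X :=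
  tcls (Var x).

Definition free_ext (Th : theory) (X : Type) (M : model Th) (f : X -> M) :
  free Th X -> M := fun u => eval (interp M) f (rep u).

Lemma eval_subst (S : signature) (X Y M : Type)
    (ops : forall o : S, ('I_(arity o) -> M) -> M) (v : Y -> M)
    (s : X -> term S Y) (t : term S X) :
  eval ops v (subst s t) = eval ops (fun x => eval ops v (s x)) t.
Proof. by elim: t => [//|o a IH] /=; congr ops; apply/funext. Qed.

Lemma eval_provable (Th : theory) (X : Type) (M : model Th) (f : X -> M) s t :
  provable s t -> eval (interp M) f s = eval (interp M) f t.
Proof.
elim=> {s t} [s t v st|t|s t _ ->|s t u _ -> _ ->|o a b _ IH] //.
  by rewrite !eval_subst; apply: interp_sat.
by rewrite /=; congr interp; apply/funext.
Qed.

Lemma free_extE (Th : theory) (X : Type) (M : model Th) (f : X -> M) t :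
  free_ext f (tcls t) = eval (interp M) f t.
Proof. by apply: eval_provable; apply: rep_cls. Qed.

Lemma free_ext_eta (Th : theory) (X : Type) (M : model Th) (f : X -> M) x :
  free_ext f (free_eta Th x) = f x.
Proof. by rewrite free_extE. Qed.

Lemma free_ext_hom (Th : theory) (X : Type) (M : model Th) (f : X -> M) :
  is_hom (free_ext f : free_model Th X -> M).
Proof. by move=> o a; rewrite free_extE. Qed.

Lemma free_ext_uniq (Th : theory) (X : Type) (M : model Th) (f : X -> M)
    (h : free_model Th X -> M) :
  is_hom h -> (forall x, h (free_eta Th x) = f x) -> forall u, h u = free_ext f u.
Proof.
move=> hh hf u; rewrite -[u]repK -/(tcls _) free_extE.
elim: (rep u) => [x|o a IH]; first exact: hf.
by rewrite -free_opE -/(interp (free_model Th X) o _) hh /=;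
   congr interp; apply/funext.
Qed.

Definition free_map (Th : theory) (X Y : Type) (f : X -> Y) :
    free Th X -> free Th Y :=
  free_ext (M := free_model Th Y) (fun x => free_eta Th (f x)).

Definition free_mu (Th : theory) (X : Type) : free Th (free Th X) -> free Th X :=
  free_ext (M := free_model Th X) id.

Definition some_val (X : Type) (o : option X) : isSome o -> X :=
  if o is Some x then fun=> x else fun h => False_rect X (notF h).

Definition all_some (I : finType) (X : Type) (f : I -> option X) :
    option (I -> X) :=
  if decP (@forallP I (fun i => isSome (f i))) is left h
  then Some (fun i => some_val (h i)) else None.

Definition all_now (n : nat) (X : Type) (d : 'I_n -> delay X) :
    option ('I_n -> X) :=
  all_some (fun i => if out (d i) is inl x then Some x else None).

Definition unstep (X : Type) (d : delay X) : delay X :=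
  if out d is inr e then e else d.

Definition par (n : nat) (X : Type) (op : ('I_n -> X) -> X) :
    ('I_n -> delay X) -> delay X :=
  coit (fun d => if all_now d is Some x then inl (op x)
                 else inr (fun i => unstep (d i))).

Arguments par : simpl never.

Lemma some_valE (X : Type) (o : option X) (h : isSome o) :
  Some (some_val h) = o.
Proof. by case: o h. Qed.

Lemma all_some_Some (I : finType) (X : Type) (x : I -> X) :
  all_some (fun i => Some (x i)) = Some x.
Proof.
rewrite /all_some; case: decP => [h|[]//].
by congr Some; apply/funext => i; apply: Some_inj; rewrite some_valE.
Qed.

Lemma all_some_None (I : finType) (X : Type) (f : I -> option X) i :
  f i = None -> all_some f = None.
Proof.
by move=> fi; rewrite /all_some; case: decP => // h; move: (h i); rewrite fi.
Qed.

Lemma all_some_inv (I : finType) (X : Type) (f : I -> option X) x i :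
  all_some f = Some x -> f i = Some (x i).
Proof.
by rewrite /all_some; case: decP => // h [<-]; rewrite some_valE.
Qed.

Lemma par_now (n : nat) (X : Type) (op : ('I_n -> X) -> X) (x : 'I_n -> X) :
  par op (fun i => now (x i)) = now (op x).
Proof. by rewrite -[LHS]outK coitE /all_now /= all_some_Some. Qed.

Lemma par_step (n : nat) (X : Type) (op : ('I_n -> X) -> X)
    (d : 'I_n -> delay X) i e :
  d i = step e -> par op d = step (par op (fun j => unstep (d j))).
Proof.
move=> di; rewrite -[LHS]outK coitE /all_now (all_some_None (i := i)) //.
by rewrite di.
Qed.

Lemma unstep_now (X : Type) (x : X) : unstep (now x) = now x.
Proof. by []. Qed.

Lemma unstep_step (X : Type) (d : delay X) : unstep (step d) = d.
Proof. by rewrite /unstep -/(inn (inr d)) innK. Qed.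

Lemma unstep_tr (X : Type) (d : delay X) n : unstep d n = d n.+1.
Proof.
rewrite /unstep /out; case d0: (d 0) => [x|] //.
by rewrite !(tr0_const _ d0).
Qed.

Lemma all_nowE (n : nat) (X : Type) (d : 'I_n -> delay X) :
  all_now d = all_some (fun i => d i 0).
Proof.
by congr all_some; apply/funext => i; rewrite /out; case: (d i 0).
Qed.

Lemma par_tr (n : nat) (X : Type) (op : ('I_n -> X) -> X)
    (d : 'I_n -> delay X) k :
  par op d k = omap op (all_some (fun i => d i k)).
Proof.
elim: k d => [|k IHk] d; rewrite -[par op d]outK coitE all_nowE.
  by case: (all_some _).
case e: (all_some _) => [x|].
  have -> : (fun i => d i k.+1) = fun i => Some (x i).
    by apply/funext => i; rewrite (tr0_const _ (all_some_inv i e)).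
  by rewrite all_some_Some.
change (par op (fun i => unstep (d i)) k = omap op (all_some (fun i => d i k.+1))).
rewrite IHk; congr (omap op (all_some _)).
by apply/funext => i; rewrite unstep_tr.
Qed.

Lemma eval_par_tr (Th : theory) (M : model Th) (X : Type)
    (v : X -> delay M) (m0 : M) (t : term Th X) n :
  eval (fun o => par (interp M o)) v t n =
  if `[< forall x, occurs x t -> isSome (v x n) >]
  then Some (eval (interp M) (fun x => odflt m0 (v x n)) t) else None.
Proof.
elim: t => [x|o a IH].
  case: asboolP => /= [/(_ x erefl)|]; first by case: (v x n).
  by case e: (v x n) => [y|] // []  _ ->; rewrite e.
change (eval (fun o => par (interp M o)) v (Op o a) n) with
  (par (interp M o) (fun i => eval (fun o => par (interp M o)) v (a i)) n).
rewrite par_tr; case: asboolP => [h|h].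
  set m := fun i => eval (interp M) (fun x => odflt m0 (v x n)) (a i).
  rewrite (_ : (fun i => _) = fun i => Some (m i)) ?all_some_Some //.
  apply/funext => i; rewrite IH; case: asboolP => // -[] x xi.
  by apply: h; exists i.
have [i hi] : exists i, ~ forall x, occurs x (a i) -> isSome (v x n).
  apply: contra_notP h => /forallNP h x [i]; move: x.
  exact: (contrapT (h i)).
by rewrite (all_some_None (i := i)) // IH; case: asboolP.
Qed.

Lemma par_sat (Th : theory) (nodrop : no_drop_equations Th) (M : model Th) s t :
  equations (t := Th) s t -> forall v : nat -> delay M,
  eval (fun o => par (interp M o)) v s = eval (fun o => par (interp M o)) v t.
Proof.
move=> st v; apply: delay_eq => n.
have st_occ := contrapT (nodrop s t st).
have key (m0 : M) : eval (fun o => par (interp M o)) v s n =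
                    eval (fun o => par (interp M o)) v t n.
  rewrite !(eval_par_tr _ m0) (interp_sat st).
  by rewrite (_ : (forall x, occurs x s -> _) =
    forall x, occurs x t -> isSome (v x n)) //;
    apply/propext; split=> h x /st_occ/h.
case e: (eval _ v s n) => [m0|]; first by rewrite -e; apply: key.
by case e': (eval _ v t n) => [m0|] //; rewrite -e -e'; apply: key.
Qed.

Definition par_model (Th : theory) (nodrop : no_drop_equations Th)
    (M : model Th) : model Th :=
  Model (par_sat nodrop (M := M)).

Definition par_law (Th : theory) (nodrop : no_drop_equations Th) (X : Type) :
    free Th (delay X) -> delay (free Th X) :=
  free_ext (M := par_model nodrop (free_model Th X)) (dmap (@free_eta Th X)).

Lemma par_law_hom (Th : theory) (nodrop : no_drop_equations Th) (X : Type) :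
  is_hom (@par_law Th nodrop X :
    free_model Th (delay X) -> par_model nodrop (free_model Th X)).
Proof. exact: free_ext_hom. Qed.

Lemma par_law_eta (Th : theory) (nodrop : no_drop_equations Th) (X : Type)
    (d : delay X) :
  par_law nodrop (free_eta Th d) = dmap (@free_eta Th X) d.
Proof. exact: (@free_ext_eta Th _ (par_model nodrop (free_model Th X))). Qed.

Lemma par_law_uniq (Th : theory) (nodrop : no_drop_equations Th) (X : Type)
    (h : free_model Th (delay X) -> par_model nodrop (free_model Th X)) :
  is_hom h -> (forall d, h (free_eta Th d) = dmap (@free_eta Th X) d) ->
  forall u, h u = par_law nodrop u.
Proof. exact: free_ext_uniq. Qed.

Record category : Type := Category {
  obj :> Type;
  hom : obj -> obj -> Type;
  idm : forall A, hom A A;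
  comp : forall A B C, hom B C -> hom A B -> hom A C;
  comp_idl : forall A B (f : hom A B), comp (idm B) f = f;
  comp_idr : forall A B (f : hom A B), comp f (idm A) = f;
  compA : forall A B C D (f : hom C D) (g : hom B C) (h : hom A B),
    comp f (comp g h) = comp (comp f g) h }.

Arguments hom {c} A B.
Arguments idm {c} A.
Arguments comp {c A B C} f g.

Declare Scope category_scope.
Notation "f '\oc' g" := (comp f g) (at level 50, left associativity) :
  category_scope.
Local Open Scope category_scope.

Record endofunctor (C : category) : Type := Endofunctor {
  fobj :> C -> C;
  fmap : forall A B, hom A B -> hom (fobj A) (fobj B);
  fmap_id : forall A, fmap (idm A) = idm (fobj A);
  fmap_comp : forall A B D (f : hom B D) (g : hom A B),
    fmap (f \oc g) = fmap f \oc fmap g }.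

Arguments fmap {C} e {A B} f.

Record monad (C : category) : Type := Monad {
  mfun :> endofunctor C;
  munit : forall A, hom A (mfun A);
  mmult : forall A, hom (mfun (mfun A)) (mfun A);
  munit_nat : forall A B (f : hom A B),
    munit B \oc f = fmap mfun f \oc munit A;
  mmult_nat : forall A B (f : hom A B),
    mmult B \oc fmap mfun (fmap mfun f) = fmap mfun f \oc mmult A;
  mmult_unitl : forall A, mmult A \oc munit (mfun A) = idm (mfun A);
  mmult_unitr : forall A, mmult A \oc fmap mfun (munit A) = idm (mfun A);
  mmultA : forall A, mmult A \oc mmult (mfun A) = mmult A \oc fmap mfun (mmult A) }.

Arguments munit {C} m A.
Arguments mmult {C} m A.

Record distributive_law (C : category) (S T : monad C) : Type :=
  DistributiveLaw {
  dlaw :> forall A, hom (S (T A)) (T (S A));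
  dlaw_nat : forall A B (f : hom A B),
    dlaw B \oc fmap S (fmap T f) = fmap T (fmap S f) \oc dlaw A;
  dlaw_unitS : forall A, dlaw A \oc munit S (T A) = fmap T (munit S A);
  dlaw_unitT : forall A, dlaw A \oc fmap S (munit T A) = munit T (S A);
  dlaw_multS : forall A, dlaw A \oc mmult S (T A) =
    fmap T (mmult S A) \oc dlaw (S A) \oc fmap S (dlaw A);
  dlaw_multT : forall A, dlaw A \oc fmap S (mmult T A) =
    mmult T (S A) \oc fmap T (dlaw A) \oc dlaw (T A) }.

Record setoid : Type := Setoid {
  scarrier :> Type;
  srel : scarrier -> scarrier -> Prop;
  srel_equiv : Equivalence srel }.

Arguments srel {s} x y.

Record setoid_map (A B : setoid) : Type := SetoidMap {
  sfun :> A -> B;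
  sfun_rel : forall x y, srel x y -> srel (sfun x) (sfun y) }.

Definition map_equiv (A B : setoid) (f g : setoid_map A B) : Prop :=
  forall x y, srel x y -> srel (f x) (g y).

Lemma map_equiv_equiv (A B : setoid) : Equivalence (@map_equiv A B).
Proof.
have [Ar As At] := srel_equiv A; have [Br Bs Bt] := srel_equiv B.
split=> [f|f g fg x y xy|f g h fg gh x y xy].
- exact: sfun_rel.
- by apply: Bs; apply: fg; apply: As.
- by apply: Bt (fg _ _ xy) (gh _ _ _); apply: Ar.
Qed.

Definition setoid_hom (A B : setoid) : Type := quot (map_equiv_equiv A B).

Definition class_of (A B : setoid) (f : setoid_map A B) : setoid_hom A B :=
  cls (map_equiv_equiv A B) f.

Lemma class_of_eq (A B : setoid) (f g : setoid_map A B) :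
  (forall x, srel (f x) (g x)) -> class_of f = class_of g.
Proof.
move=> fg; apply/clsP => x y xy; have [_ _ Bt] := srel_equiv B.
exact: Bt (sfun_rel f xy) (fg y).
Qed.

Lemma class_ofE (A B : setoid) (f : setoid_map A B) x :
  srel (rep (class_of f) x) (f x).
Proof.
by apply: (rep_cls (map_equiv_equiv A B)); have [Ar _ _] := srel_equiv A.
Qed.

Lemma class_of_rep (A B : setoid) (f : setoid_hom A B) : class_of (rep f) = f.
Proof. exact: repK. Qed.

Definition id_map (A : setoid) : setoid_map A A :=
  @SetoidMap A A id (fun _ _ => id).

Definition comp_map (A B C : setoid) (f : setoid_map B C) (g : setoid_map A B) :
    setoid_map A C :=
  @SetoidMap A C (fun x => f (g x)) (fun x y xy => sfun_rel f (sfun_rel g xy)).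

Definition hom_comp (A B C : setoid) (f : setoid_hom B C) (g : setoid_hom A B) :
  setoid_hom A C := class_of (comp_map (rep f) (rep g)).

Lemma hom_compE (A B C : setoid) (f : setoid_map B C) (g : setoid_map A B) :
  hom_comp (class_of f) (class_of g) = class_of (comp_map f g).
Proof.
apply: class_of_eq => x /=; have [_ _ Ct] := srel_equiv C.
exact: Ct (class_ofE f _) (sfun_rel f (class_ofE g x)).
Qed.

Lemma hom_idl (A B : setoid) (f : setoid_hom A B) :
  hom_comp (class_of (id_map B)) f = f.
Proof.
rewrite -[f]class_of_rep hom_compE; apply: class_of_eq => x /=.
by case: (srel_equiv B).
Qed.

Lemma hom_idr (A B : setoid) (f : setoid_hom A B) :
  hom_comp f (class_of (id_map A)) = f.
Proof.
rewrite -[f]class_of_rep hom_compE; apply: class_of_eq => x /=.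
by case: (srel_equiv B).
Qed.

Lemma hom_compA (A B C D : setoid) (f : setoid_hom C D) (g : setoid_hom B C)
    (h : setoid_hom A B) :
  hom_comp f (hom_comp g h) = hom_comp (hom_comp f g) h.
Proof.
rewrite -[f]class_of_rep -[g]class_of_rep -[h]class_of_rep !hom_compE.
by apply: class_of_eq => x /=; case: (srel_equiv D).
Qed.

Definition setoids : category :=
  Category (fun A => hom_idl (A := A)) hom_idr hom_compA.

Definition delay_setoid (A : setoid) : setoid :=
  Setoid (wbisim_equiv (srel_equiv A)).

Lemma dmap_wbisim (A B : setoid) (f g : setoid_map A B) (d e : delay A) :
  map_equiv f g -> wbisim srel d e -> wbisim srel (dmap f d) (dmap g e).
Proof.
move=> fg /wbisimP[l r]; apply/wbisimP; split=> x /conv_dmap[y yc ->].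
  have [z ez yz] := l _ yc; exists (g z); last exact: fg.
  by apply/conv_dmap; exists z.
have [z dz yz] := r _ yc; exists (f z); last exact: fg.
by apply/conv_dmap; exists z.
Qed.

Definition delay_map (A B : setoid) (f : setoid_map A B) :
    setoid_map (delay_setoid A) (delay_setoid B) :=
  @SetoidMap (delay_setoid A) (delay_setoid B) (dmap f)
    (fun x y => dmap_wbisim (@sfun_rel A B f)).

Definition delay_hom (A B : setoid) (f : setoid_hom A B) :
    setoid_hom (delay_setoid A) (delay_setoid B) :=
  class_of (delay_map (rep f)).

Lemma delay_homE (A B : setoid) (f : setoid_map A B) :
  delay_hom (class_of f) = class_of (delay_map f).
Proof.
by apply/clsP => d e; apply: dmap_wbisim; apply: (rep_cls (map_equiv_equiv A B)).
Qed.

Lemma wbisim_conv_eq (A : setoid) (d e : delay A) :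
  (forall x, conv d x <-> conv e x) -> wbisim srel d e.
Proof.
have [Ar _ _] := srel_equiv A.
by move=> de; apply/wbisimP; split=> x /de xc; exists x.
Qed.

Lemma delay_hom_id (A : setoid) :
  delay_hom (idm (c := setoids) A) = idm (c := setoids) (delay_setoid A).
Proof.
rewrite [LHS]delay_homE; apply: class_of_eq => d; apply: wbisim_conv_eq => x.
by rewrite conv_dmap; split=> [[y dy ->]|] //; exists x.
Qed.

Lemma delay_hom_comp (A B D : setoids) (f : hom B D) (g : hom A B) :
  delay_hom (f \oc g) =
  comp (c := setoids) (delay_hom f) (delay_hom g).
Proof.
rewrite -[f]class_of_rep -[g]class_of_rep [in LHS]/comp /=.
rewrite hom_compE !delay_homE [RHS]hom_compE.
apply: class_of_eq => d; apply: wbisim_conv_eq => x /=; rewrite !conv_dmap.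
split=> [[y dy ->]|[y /conv_dmap[z dz ->] ->]]; last by exists z.
by exists (rep g y) => //; apply/conv_dmap; exists y.
Qed.

Definition delay_functor : endofunctor setoids :=
  @Endofunctor setoids delay_setoid delay_hom delay_hom_id delay_hom_comp.

Lemma delay_fmapE (A B : setoid) (f : setoid_map A B) :
  @fmap setoids delay_functor A B (class_of f) = class_of (delay_map f).
Proof. exact: delay_homE. Qed.

Lemma now_wbisim (A : setoid) (x y : A) :
  srel x y -> wbisim srel (now x) (now y).
Proof. by move=> xy; exact: (@wbisim_nowl _ _ x 0 y). Qed.

Definition now_map (A : setoid) : setoid_map A (delay_setoid A) :=
  @SetoidMap A (delay_setoid A) (@now A) (@now_wbisim A).

Lemma djoin_wbisim (A : setoid) (d e : delay (delay A)) :
  wbisim (wbisim srel) d e -> wbisim srel (djoin d) (djoin e).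
Proof.
move=> /wbisimP[l r]; apply/wbisimP; split=> x /conv_djoin[d' dd'].
  have [e' ee' /wbisimP[l' _]] := l _ dd' => /l'[y e'y xy].
  by exists y => //; apply/conv_djoin; exists e'.
have [e' ee' /wbisimP[_ r']] := r _ dd' => /r'[y e'y xy].
by exists y => //; apply/conv_djoin; exists e'.
Qed.

Definition djoin_map (A : setoid) :
    setoid_map (delay_setoid (delay_setoid A)) (delay_setoid A) :=
  @SetoidMap (delay_setoid (delay_setoid A)) (delay_setoid A) (@djoin A)
    (@djoin_wbisim A).

Definition delay_unit (A : setoids) : hom A (delay_functor A) :=
  class_of (now_map A).

Definition delay_mult (A : setoids) :
    hom (delay_functor (delay_functor A)) (delay_functor A) :=
  class_of (djoin_map A).

Lemma delay_unit_nat (A B : setoids) (f : hom A B) :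
  delay_unit B \oc f = fmap delay_functor f \oc delay_unit A.
Proof.
rewrite -[f]class_of_rep [LHS]hom_compE delay_fmapE [RHS]hom_compE.
apply: class_of_eq => x; apply: wbisim_conv_eq => y /=.
by rewrite dmap_now.
Qed.

Lemma delay_mult_nat (A B : setoids) (f : hom A B) :
  delay_mult B \oc fmap delay_functor (fmap delay_functor f) =
  fmap delay_functor f \oc delay_mult A.
Proof.
rewrite -[f]class_of_rep !delay_fmapE.
rewrite [LHS]hom_compE [RHS]hom_compE.
apply: class_of_eq => d; apply: wbisim_conv_eq => y /=.
rewrite conv_djoin conv_dmap; split.
  move=> [e /conv_dmap[z dz ->] /conv_dmap[x zx ->]].
  by exists x => //; apply/conv_djoin; exists z.
move=> [x /conv_djoin[e de ex] ->]; exists (dmap (rep f) e).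
  by apply/conv_dmap; exists e.
by apply/conv_dmap; exists x.
Qed.

Lemma delay_unitl (A : setoids) :
  delay_mult A \oc delay_unit (delay_functor A) = idm (delay_functor A).
Proof.
rewrite [LHS]hom_compE; apply: class_of_eq => d; apply: wbisim_conv_eq => y /=.
by rewrite djoin_now.
Qed.

Lemma delay_unitr (A : setoids) :
  delay_mult A \oc fmap delay_functor (delay_unit A) = idm (delay_functor A).
Proof.
rewrite delay_fmapE [LHS]hom_compE.
apply: class_of_eq => d; apply: wbisim_conv_eq => y /=.
rewrite conv_djoin; split=> [[e /conv_dmap[x dx ->] /conv_now ->] //|dy].
by exists (now y); [apply/conv_dmap; exists y | apply/conv_now].
Qed.

Lemma delay_multA (A : setoids) :
  delay_mult A \oc delay_mult (delay_functor A) =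
  delay_mult A \oc fmap delay_functor (delay_mult A).
Proof.
rewrite delay_fmapE [LHS]hom_compE [RHS]hom_compE.
apply: class_of_eq => d; apply: wbisim_conv_eq => y /=.
rewrite !conv_djoin; split.
  move=> [e /conv_djoin[d' dd' d'e] ey].
  exists (djoin d'); first by apply/conv_dmap; exists d'.
  by apply/conv_djoin; exists e.
move=> [e /conv_dmap[d' dd' ->] /conv_djoin[e' d'e' e'y]].
by exists e' => //; apply/conv_djoin; exists d'.
Qed.

Definition D_sd : monad setoids :=
  @Monad setoids delay_functor delay_unit delay_mult delay_unit_nat delay_mult_nat
    delay_unitl delay_unitr delay_multA.

Definition rename (S : signature) (X Y : Type) (f : X -> Y) :
  term S X -> term S Y := subst (fun x => Var (f x)).

Definition term_rel (Th : theory) (X : Type) (R : X -> X -> Prop)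
    (u v : free Th X) : Prop :=
  exists n (t : term Th 'I_n) (x y : 'I_n -> X),
    [/\ forall i, R (x i) (y i), u = tcls (rename x t) & v = tcls (rename y t)].

Definition free_rel (Th : theory) (X : Type) (R : X -> X -> Prop) :
  free Th X -> free Th X -> Prop :=
  clos_refl_sym_trans (free Th X) (term_rel R).

Lemma free_rel_equiv (Th : theory) (X : Type) (R : X -> X -> Prop) :
  Equivalence (@free_rel Th X R).
Proof.
split=> [u|u v|u v w]; [exact: rst_refl | exact: rst_sym | exact: rst_trans].
Qed.

Lemma free_map_rename (Th : theory) (X Y : Type) (f : X -> Y) (t : term Th X) :
  free_map f (tcls t) = tcls (rename f t).
Proof. by rewrite /free_map free_extE (eval_free (fun x => Var (f x))). Qed.

Lemma rename_comp (S : signature) (X Y Z : Type) (f : Y -> Z) (g : X -> Y)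
    (t : term S X) : rename f (rename g t) = rename (fun x => f (g x)) t.
Proof. by rewrite /rename /subst eval_subst. Qed.

Lemma rename_id (S : signature) (X : Type) (t : term S X) : rename id t = t.
Proof.
by elim: t => [//|o a IH]; congr (Op o _); apply/funext => i; apply: IH.
Qed.

Lemma free_map_comp (Th : theory) (X Y Z : Type) (f : Y -> Z) (g : X -> Y)
    (u : free Th X) : free_map f (free_map g u) = free_map (fun x => f (g x)) u.
Proof.
by rewrite -[u]repK -/(tcls _) !free_map_rename rename_comp.
Qed.

Lemma free_map_id (Th : theory) (X : Type) (u : free Th X) : free_map id u = u.
Proof. by rewrite -[u]repK -/(tcls _) free_map_rename rename_id. Qed.

Lemma free_mu_subst (Th : theory) (X Y : Type) (s : Y -> term Th X)
    (t : term Th Y) :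
  free_mu (tcls (rename (fun y => tcls (s y)) t)) = tcls (subst s t).
Proof.
by rewrite /free_mu free_extE /rename /subst eval_subst eval_free.
Qed.

Lemma term_finite (S : signature) (X : Type) (t : term S X) :
  {n & {x : 'I_n -> X & {t' : term S 'I_n | t = rename x t'}}}.
Proof.
elim: t => [x|o a IH].
  by exists 1, (fun=> x), (Var ord0).
pose n i := projT1 (IH i).
pose x i : 'I_(n i) -> X := projT1 (projT2 (IH i)).
pose t i : term S 'I_(n i) := sval (projT2 (projT2 (IH i))).
have tE i : a i = rename (x i) (t i) := svalP (projT2 (projT2 (IH i))).
pose I := {i : 'I_(arity o) & 'I_(n i)}.
exists #|{: I}|, (fun k => x (tag (enum_val k)) (tagged (enum_val k))).
exists (Op o (fun i => rename (fun j => enum_rank (Tagged (fun i => 'I_(n i)) j))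
                              (t i))).
congr (Op o _); apply/funext => i; rewrite tE.
rewrite -[RHS]/(rename _ (rename _ (t i))) rename_comp.
by congr (rename _ _); apply/funext => j; rewrite enum_rankK.
Qed.

(* T(R) is the kernel of the image under T of the projection X -> X/R. *)
Lemma free_relP (Th : theory) (X : Type) (R : X -> X -> Prop)
    (E : Equivalence R) (u v : free Th X) :
  free_rel R u v <-> free_map (cls E) u = free_map (cls E) v.
Proof.
split=> [|uv].
  elim=> {u v} [u v [n [t [x [y [xy -> ->]]]]]|//|u v _ ->|u v w _ -> _ ->] //.
  rewrite !free_map_rename !rename_comp; congr (tcls (rename _ t)).
  by apply/funext => i; apply/clsP.
have base w : term_rel R w (free_map (fun x => rep (cls E x)) w).
  rewrite -[w]repK -/(tcls _).
  have [n [x [t ->]]] := term_finite (rep w).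
  exists n, t, x, (fun i => rep (cls E (x i))); split=> //; last first.
    by rewrite free_map_rename rename_comp.
  by move=> i; have [_ Rs _] := E; apply: Rs; apply: rep_cls.
apply: (rst_trans _ _ _ (free_map (fun x => rep (cls E x)) u)).
  by apply: rst_step; apply: base.
rewrite -(free_map_comp (@rep _ _ E)) uv free_map_comp.
by apply: rst_sym; apply: rst_step; apply: base.
Qed.

Definition free_setoid (Th : theory) (A : setoid) : setoid :=
  @Setoid (free Th A) (free_rel srel) (free_rel_equiv Th srel).

Lemma free_map_rel (Th : theory) (A B : setoid) (f g : setoid_map A B)
    (u v : free Th A) :
  map_equiv f g -> free_rel srel u v ->
  free_rel srel (free_map f u) (free_map g v).
Proof.
move=> fg /(free_relP (srel_equiv A)) uv; apply/(free_relP (srel_equiv B)).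
have [Ar As _] := srel_equiv A; have [_ Bs Bt] := srel_equiv B.
have E (h : setoid_map A B) w :
    map_equiv f h -> free_map (cls (srel_equiv B)) (free_map h w) =
    free_map (fun q => cls (srel_equiv B) (f (rep q)))
             (free_map (cls (srel_equiv A)) w).
  move=> fh; rewrite !free_map_comp; congr (free_map _ w); apply/funext => x.
  by apply/clsP; apply: Bs; apply: fh; apply: rep_cls.
by rewrite (E _ f) ?(E _ g) ?uv //; apply: sfun_rel.
Qed.

Definition free_setoid_map (Th : theory) (A B : setoid) (f : setoid_map A B) :
    setoid_map (free_setoid Th A) (free_setoid Th B) :=
  @SetoidMap (free_setoid Th A) (free_setoid Th B) (free_map f)
    (fun u v => free_map_rel (@sfun_rel A B f)).

Definition free_hom (Th : theory) (A B : setoid) (f : setoid_hom A B) :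
    setoid_hom (free_setoid Th A) (free_setoid Th B) :=
  class_of (free_setoid_map Th (rep f)).

Lemma free_homE (Th : theory) (A B : setoid) (f : setoid_map A B) :
  free_hom Th (class_of f) = class_of (free_setoid_map Th f).
Proof.
by apply/clsP => u v; apply: free_map_rel; apply: (rep_cls (map_equiv_equiv A B)).
Qed.

Lemma srel_eq (A : setoid) (x y : A) : x = y -> srel x y.
Proof. by move=> ->; case: (srel_equiv A). Qed.

Lemma free_hom_id (Th : theory) (A : setoid) :
  free_hom Th (idm (c := setoids) A) = idm (c := setoids) (free_setoid Th A).
Proof.
rewrite [LHS]free_homE; apply: class_of_eq => u; apply: srel_eq.
exact: free_map_id.
Qed.

Lemma free_hom_comp (Th : theory) (A B D : setoids) (f : hom B D) (g : hom A B) :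
  free_hom Th (f \oc g) =
  comp (c := setoids) (free_hom Th f) (free_hom Th g).
Proof.
rewrite -[f]class_of_rep -[g]class_of_rep [in LHS]/comp /=.
rewrite hom_compE !free_homE [RHS]hom_compE.
by apply: class_of_eq => u; apply: srel_eq; rewrite /= free_map_comp.
Qed.

Definition free_functor (Th : theory) : endofunctor setoids :=
  @Endofunctor setoids (free_setoid Th) (@free_hom Th)
    (@free_hom_id Th) (@free_hom_comp Th).

Lemma free_fmapE (Th : theory) (A B : setoid) (f : setoid_map A B) :
  @fmap setoids (free_functor Th) A B (class_of f) =
  class_of (free_setoid_map Th f).
Proof. exact: free_homE. Qed.

Lemma free_eta_rel (Th : theory) (A : setoid) (x y : A) :
  srel x y -> free_rel srel (free_eta Th x) (free_eta Th y).
Proof.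
move=> xy; apply: rst_step.
by exists 1, (Var ord0), (fun=> x), (fun=> y).
Qed.

Definition free_eta_map (Th : theory) (A : setoid) :
    setoid_map A (free_setoid Th A) :=
  @SetoidMap A (free_setoid Th A) (@free_eta Th A) (@free_eta_rel Th A).

Lemma free_map_eta (Th : theory) (X Y : Type) (f : X -> Y) x :
  free_map f (free_eta Th x) = free_eta Th (f x).
Proof. exact: (@free_ext_eta Th X (free_model Th Y)). Qed.

Lemma free_mu_hom (Th : theory) (X : Type) :
  is_hom (@free_mu Th X : free_model Th (free Th X) -> free_model Th X).
Proof. exact: free_ext_hom. Qed.

Lemma free_mu_eta (Th : theory) (X : Type) (u : free Th X) :
  free_mu (free_eta Th u) = u.
Proof. exact: (@free_ext_eta Th (free Th X) (free_model Th X)). Qed.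

Lemma free_mu_nat (Th : theory) (X Y : Type) (f : X -> Y)
    (u : free Th (free Th X)) :
  free_mu (free_map (free_map f) u) = free_map f (free_mu u).
Proof.
have -> : u = tcls (rename (fun x => tcls (rep x)) (rep u)).
  rewrite -[LHS]repK -/(tcls _); congr tcls.
  rewrite -[LHS]rename_id; congr (rename _ _).
  by apply/funext => x; rewrite /tcls repK.
rewrite free_mu_subst !free_map_rename rename_comp.
rewrite (_ : (fun x => _) = fun x => tcls (rename f (rep x))); last first.
  by apply/funext => x; rewrite free_map_rename.
by rewrite free_mu_subst /rename /subst -eval_subst.
Qed.

Lemma free_mu_rel (Th : theory) (A : setoid) (u v : free Th (free Th A)) :
  free_rel (free_rel srel) u v -> free_rel srel (free_mu u) (free_mu v).
Proof.
move=> /(free_relP (free_rel_equiv Th srel)) uv.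
apply/(free_relP (srel_equiv A)); rewrite -!free_mu_nat.
have E w : free_map (free_map (cls (srel_equiv A))) w =
    free_map (fun q => free_map (cls (srel_equiv A)) (rep q))
             (free_map (cls (free_rel_equiv Th srel)) w).
  rewrite free_map_comp; congr (free_map _ w); apply/funext => x.
  by apply/esym/(free_relP (srel_equiv A)); apply: rep_cls.
by rewrite !E uv.
Qed.

Definition free_mu_map (Th : theory) (A : setoid) :
    setoid_map (free_setoid Th (free_setoid Th A)) (free_setoid Th A) :=
  @SetoidMap (free_setoid Th (free_setoid Th A)) (free_setoid Th A)
    (@free_mu Th A) (@free_mu_rel Th A).

Definition free_unit (Th : theory) (A : setoids) : hom A (free_functor Th A) :=
  class_of (free_eta_map Th A).

Definition free_mult (Th : theory) (A : setoids) :
    hom (free_functor Th (free_functor Th A)) (free_functor Th A) :=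
  class_of (free_mu_map Th A).

Lemma free_unit_nat (Th : theory) (A B : setoids) (f : hom A B) :
  free_unit Th B \oc f = fmap (free_functor Th) f \oc free_unit Th A.
Proof.
rewrite -[f]class_of_rep free_fmapE [LHS]hom_compE [RHS]hom_compE.
by apply: class_of_eq => x; apply: srel_eq; rewrite /= free_map_eta.
Qed.

Lemma free_mult_nat (Th : theory) (A B : setoids) (f : hom A B) :
  free_mult Th B \oc fmap (free_functor Th) (fmap (free_functor Th) f) =
  fmap (free_functor Th) f \oc free_mult Th A.
Proof.
rewrite -[f]class_of_rep !free_fmapE [LHS]hom_compE [RHS]hom_compE.
by apply: class_of_eq => u; apply: srel_eq; rewrite /= free_mu_nat.
Qed.

Lemma free_unitl (Th : theory) (A : setoids) :
  free_mult Th A \oc free_unit Th (free_functor Th A) = idm (free_functor Th A).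
Proof.
rewrite [LHS]hom_compE; apply: class_of_eq => u; apply: srel_eq.
exact: free_mu_eta.
Qed.

Lemma free_unitr (Th : theory) (A : setoids) :
  free_mult Th A \oc fmap (free_functor Th) (free_unit Th A) =
  idm (free_functor Th A).
Proof.
rewrite free_fmapE [LHS]hom_compE; apply: class_of_eq => u; apply: srel_eq => /=.
rewrite -[u]repK -/(tcls _) free_map_rename (free_mu_subst Var).
by rewrite -[subst _ _]/(rename id _) rename_id.
Qed.

Lemma free_ext_free_map (Th : theory) (X Y : Type) (M : model Th) (f : Y -> M)
    (g : X -> Y) u : free_ext f (free_map (Th := Th) g u) = free_ext (fun x => f (g x)) u.
Proof.
by rewrite -[u]repK -/(tcls _) free_map_rename !free_extE eval_subst.
Qed.

Lemma free_mu_mu (Th : theory) (X : Type) (u : free Th (free Th (free Th X))) :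
  free_mu (free_mu u) = free_mu (free_map (@free_mu Th X) u).
Proof.
rewrite [RHS]free_ext_free_map.
apply: (free_ext_uniq (M := free_model Th X) (f := @free_mu Th X)
  (h := fun u : free_model Th (free Th (free Th X)) => free_mu (free_mu u))).
  by move=> o a; rewrite !free_mu_hom.
by move=> x; rewrite free_mu_eta.
Qed.

Lemma free_multA (Th : theory) (A : setoids) :
  free_mult Th A \oc free_mult Th (free_functor Th A) =
  free_mult Th A \oc fmap (free_functor Th) (free_mult Th A).
Proof.
rewrite free_fmapE [LHS]hom_compE [RHS]hom_compE.
by apply: class_of_eq => u; apply: srel_eq; apply: free_mu_mu.
Qed.

Definition T_sd (Th : theory) : monad setoids :=
  @Monad setoids (free_functor Th) (@free_unit Th) (@free_mult Th)
    (@free_unit_nat Th) (@free_mult_nat Th) (@free_unitl Th) (@free_unitr Th)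
    (@free_multA Th).

(* Main.v *)
(* The two sides of the naturality, unit and T-multiplication laws are
   homomorphisms out of a free model, so those laws hold strictly, because
   [now] and [dmap h], for [h] a homomorphism, are homomorphisms with respect to
   parallel lifting.  Only the compatibility with [djoin] needs weak
   bisimilarity: the parallel lifting of an operation returns exactly when all
   of its arguments return, so both sides of that law return the same values,
   although they may do so after different numbers of steps. *)
From Stdlib Require Import RelationClasses.
From mathcomp Require Import all_boot boolp.
Require Import Defs.

Set Implicit Arguments.
Unset Strict Implicit.
Unset Printing Implicit Defensive.

Local Open Scope category_scope.

(** * Values returned by a parallel lifting *)

Lemma conv_choice (n : nat) (X : Type) (d : 'I_n -> delay X)
    (P : 'I_n -> X -> Prop) :
  (forall i, exists2 x, conv (d i) x & P i x) ->
  exists2 x : 'I_n -> X, forall i, conv (d i) (x i) & forall i, P i (x i).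
Proof.
move=> h.
have /choice[x xP] : forall i, exists x, conv (d i) x /\ P i x.
  by move=> i; have [x dx Px] := h i; exists x.
by exists x => i; have [] := xP i.
Qed.

Lemma conv_par (n : nat) (X : Type) (op : ('I_n -> X) -> X)
    (d : 'I_n -> delay X) y :
  conv (par op d) y <->
  exists2 x : 'I_n -> X, forall i, conv (d i) (x i) & y = op x.
Proof.
split=> [[k]|[x dx ->]].
  rewrite par_tr; case e: (all_some _) => [x|//] [<-].
  by exists x => // i; exists k; apply: (all_some_inv i e).
have [k kP] := choice dx.
(* Argument [i] has returned by step [k i], and a delay keeps its value once it has returned, so at
   the maximum all arguments are available. *)
exists (\max_i k i); rewrite par_tr.
rewrite (_ : (fun i => _) = fun i => Some (x i)) ?all_some_Some //.
by apply/funext => i; apply: tr_leq (kP i); apply: leq_bigmax.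
Qed.

(** * Homomorphisms, free models and congruence *)

Lemma dmap_tr (X Y : Type) (f : X -> Y) (d : delay X) n :
  dmap f d n = omap f (d n).
Proof.
elim: n d => [|n IHn] d; rewrite -[d]outK; case: (out d) => [x|e];
  rewrite /inn ?dmap_now ?dmap_step //; exact: IHn.
Qed.

Lemma par_model_tr (Th : theory) (nodrop : no_drop_equations Th) (M : model Th)
    (o : Th) (a : 'I_(arity o) -> delay M) n :
  (interp (par_model nodrop M) o a : delay M) n =
  omap (interp M o) (all_some (fun i => a i n)).
Proof. exact: par_tr. Qed.

(** [dmap] leaves the timing unchanged, so both sides return at the same step, and there the claim
    is that [h] commutes with the operation. *)
Lemma dmap_hom (Th : theory) (nodrop : no_drop_equations Th) (M N : model Th)
    (h : M -> N) :
  is_hom h -> is_hom (dmap h : par_model nodrop M -> par_model nodrop N).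
Proof.
move=> hh o a; apply: delay_eq => n.
rewrite dmap_tr !par_model_tr; case e: (all_some _) => [x|].
  rewrite (_ : (fun i => _) = fun i => Some (h (x i))).
    by rewrite all_some_Some /= hh.
  by apply/funext => i; rewrite dmap_tr (all_some_inv i e).
(* Some argument has not returned by step [n]; neither has its image under [dmap h], so the right
   side is undefined as well. *)
case e': (all_some _) => [x|//].
suff : isSome (all_some (fun i => a i n)) by rewrite e.
rewrite /all_some; case: decP => // -[] i.
by have := all_some_inv i e'; rewrite dmap_tr; case: (a i n).
Qed.

Lemma now_hom (Th : theory) (nodrop : no_drop_equations Th) (M : model Th) :
  is_hom (@now M : M -> par_model nodrop M).
Proof. by move=> o a; rewrite /= par_now. Qed.

(** Both maps are the unique extension of the same map on generators. This reduces each strict law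
    to its values on [free_eta]. *)
Lemma free_hom_eq (Th : theory) (X : Type) (M : model Th)
    (g h : free_model Th X -> M) :
  is_hom g -> is_hom h -> (forall x, g (free_eta Th x) = h (free_eta Th x)) ->
  forall u, g u = h u.
Proof.
move=> gg hh gh u; rewrite (free_ext_uniq gg gh).
by rewrite -(free_ext_uniq (f := fun x => h (free_eta Th x)) hh).
Qed.

Lemma free_map_hom (Th : theory) (X Y : Type) (f : X -> Y) :
  is_hom (free_map f : free_model Th X -> free_model Th Y).
Proof. exact: free_ext_hom. Qed.

(** Serves the [djoin] law, which is not an equality of homomorphisms and so is out of reach of
    [free_hom_eq]. *)
Lemma free_ind (Th : theory) (X : Type) (P : free Th X -> Prop) :
  (forall x, P (free_eta Th x)) ->
  (forall o (a : 'I_(arity o) -> free Th X),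
     (forall i, P (a i)) -> P (free_op a)) ->
  forall u, P u.
Proof.
move=> Peta Pop u; rewrite -[u]repK -/(tcls _).
by elim: (rep u) => [//|o a IH]; rewrite -free_opE; apply: Pop.
Qed.

(** By [free_relP], [free_rel R] is the kernel of [free_map (cls E)], and the kernel of a
    homomorphism is a congruence. *)
Lemma free_op_rel (Th : theory) (X : Type) (R : X -> X -> Prop)
    (E : Equivalence R) (o : Th) (a b : 'I_(arity o) -> free Th X) :
  (forall i, free_rel R (a i) (b i)) -> free_rel R (free_op a) (free_op b).
Proof.
move=> ab; apply/(free_relP E).
rewrite !(free_map_hom (cls E) (o := o)); congr (@free_op Th _ o).
apply/funext => i.
by apply/(free_relP E).
Qed.

(** By [wbisimP] and [conv_par] only the returned values count, and partners for them can be chosen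
    argument by argument. *)
Lemma par_wbisim (n : nat) (X : Type) (R : X -> X -> Prop)
    (op : ('I_n -> X) -> X) (d e : 'I_n -> delay X) :
  (forall x y, (forall i, R (x i) (y i)) -> R (op x) (op y)) ->
  (forall i, wbisim R (d i) (e i)) -> wbisim R (par op d) (par op e).
Proof.
move=> opR de; apply/wbisimP; split=> z /conv_par[x xP ->].
  have [i|y ey xy] := @conv_choice _ _ e (fun i => R (x i)).
    by have /wbisimP[l _] := de i; apply: l.
  by exists (op y); [apply/conv_par; exists y | apply: opR].
have [i|y dy yx] := @conv_choice _ _ d (fun i y => R y (x i)).
  by have /wbisimP[_ r] := de i; apply: r.
by exists (op y); [apply/conv_par; exists y | apply: opR].
Qed.

(** * The parallel law on free models *)

Section ParLaw.
Variables (Th : theory) (nodrop : no_drop_equations Th).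

Lemma par_law_op (X : Type) (o : Th) (a : 'I_(arity o) -> free Th (delay X)) :
  par_law nodrop (free_op a) =
  par (@free_op Th X o) (fun i => par_law nodrop (a i)).
Proof. exact: (@par_law_hom Th nodrop X o a). Qed.

Lemma par_law_rel (A : setoid) (u v : free Th (delay A)) :
  free_rel (wbisim srel) u v ->
  wbisim (free_rel srel) (par_law nodrop u) (par_law nodrop v).
Proof.
have [Wr Ws Wt] := wbisim_equiv (free_rel_equiv Th (@srel A)).
elim=> {u v} [u v [n [t [x [y [xy -> ->]]]]]|u|u v _ uv|u v w _ uv _ vw].
(* In the generating case both sides share the term [t]; induction on it leaves variables to
   [dmap_wbisim] and operations to [par_wbisim]. *)
- elim: t => [i|o a IH].
    rewrite !par_law_eta.
    exact: (@dmap_wbisim A (free_setoid Th A) (free_eta_map Th A)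
              (free_eta_map Th A) _ _ (@free_eta_rel Th A)).
  rewrite -[tcls (rename x _)]free_opE -[tcls (rename y _)]free_opE.
  rewrite !par_law_op; apply: par_wbisim => // b c.
  exact: (free_op_rel (srel_equiv A)).
- exact: Wr.
- exact: Ws.
- exact: Wt vw.
Qed.

Definition par_law_map (A : setoid) :
    setoid_map (free_setoid Th (delay_setoid A))
               (delay_setoid (free_setoid Th A)) :=
  @SetoidMap (free_setoid Th (delay_setoid A)) (delay_setoid (free_setoid Th A))
    (@par_law Th nodrop A) (@par_law_rel A).

Lemma par_law_nat (X Y : Type) (f : X -> Y) (u : free Th (delay X)) :
  par_law nodrop (free_map (dmap f) u) = dmap (free_map f) (par_law nodrop u).
Proof.
apply: (free_hom_eq (M := par_model nodrop (free_model Th Y))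
  (g := fun u => par_law nodrop (free_map (dmap f) u))
  (h := fun u => dmap (free_map f) (par_law nodrop u))) => [||d].
- by move=> o a; rewrite free_map_hom par_law_hom.
- by move=> o a; rewrite par_law_hom (dmap_hom (free_map_hom f)).
- rewrite free_map_eta !par_law_eta; apply: delay_eq => n; rewrite !dmap_tr.
  by case: (d n) => //= x; rewrite free_map_eta.
Qed.

Lemma par_law_now (X : Type) (u : free Th X) :
  par_law nodrop (free_map (@now X) u) = now u.
Proof.
apply: (free_hom_eq (M := par_model nodrop (free_model Th X))
  (g := fun u => par_law nodrop (free_map (@now X) u))
  (h := @now (free Th X))) => [||x].
- by move=> o a; rewrite free_map_hom par_law_hom.
- exact: now_hom.
- by rewrite free_map_eta par_law_eta dmap_now.
Qed.

Lemma par_law_mu (X : Type) (u : free Th (free Th (delay X))) :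
  par_law nodrop (free_mu u) =
  dmap (@free_mu Th X) (par_law nodrop (free_map (@par_law Th nodrop X) u)).
Proof.
apply: (free_hom_eq (M := par_model nodrop (free_model Th X))
  (g := fun u => par_law nodrop (free_mu u))
  (h := fun u => dmap (@free_mu Th X)
     (par_law nodrop (free_map (@par_law Th nodrop X) u)))) => [||d].
- by move=> o a; rewrite free_mu_hom par_law_hom.
- move=> o a; rewrite free_map_hom par_law_hom.
  by rewrite (dmap_hom (@free_mu_hom Th X)).
(* On a generator the right side applies [free_mu] after [free_eta] to each returned value, which is
   the identity. *)
- rewrite free_map_eta free_mu_eta par_law_eta; apply: delay_eq => n.
  by rewrite !dmap_tr; case: (_ n) => //= x; rewrite free_mu_eta.
Qed.

(** Stated for [conv] because the timings differ: if argument [i] of an operation takes [p i] outer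
    and [q i] inner steps, the left side waits for the maximum of the sums [p i + q i], the right
    side for the sum of the two maxima. *)
Lemma par_law_djoin (X : Type) (u : free Th (delay (delay X))) y :
  conv (par_law nodrop (free_map (@djoin X) u)) y <->
  conv (djoin (dmap (@par_law Th nodrop X) (par_law nodrop u))) y.
Proof.
elim/free_ind: u y => [dd|o a IH] y.
  rewrite free_map_eta !par_law_eta conv_djoin conv_dmap; split.
    move=> [x /conv_djoin[d ddd dx] ->].
    exists (dmap (@free_eta Th X) d); last by apply/conv_dmap; exists x.
    apply/conv_dmap; exists (free_eta Th d); last by rewrite par_law_eta.
    by apply/conv_dmap; exists d.
  move=> [_ /conv_dmap[_ /conv_dmap[d ddd ->] ->]].
  rewrite par_law_eta => /conv_dmap[x dx ->].
  by exists x => //; apply/conv_djoin; exists d.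
rewrite (free_map_hom (@djoin X) (o := o)) !par_law_op conv_par conv_djoin.
split=> [[x xP ->]|[_ /conv_dmap[_ /conv_par[e eP ->] ->]]].
  (* By induction each [x i] is reached through an intermediate value [e i] of the outer delay;
     [free_op e] is then the intermediate value for the whole operation. *)
  have [i|e ae ex] := @conv_choice _ _ (fun i => par_law nodrop (a i))
      (fun i e => conv (par_law nodrop e) (x i)).
    have /IH/conv_djoin[_ /conv_dmap[e ae ->] ex] := xP i.
    by exists e.
  exists (par_law nodrop (free_op e)).
    by apply/conv_dmap; exists (free_op e) => //; apply/conv_par; exists e.
  by rewrite par_law_op; apply/conv_par; exists x.
rewrite par_law_op => /conv_par[x ex ->]; exists x => // i.
apply/IH/conv_djoin; exists (par_law nodrop (e i)) => //.
by apply/conv_dmap; exists (e i).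
Qed.

(** * The distributive law on setoids *)

Definition sd_law (A : setoids) : hom (T_sd Th (D_sd A)) (D_sd (T_sd Th A)) :=
  class_of (par_law_map A).

Lemma sd_law_nat (A B : setoids) (f : hom A B) :
  sd_law B \oc fmap (T_sd Th) (fmap D_sd f) =
  fmap D_sd (fmap (T_sd Th) f) \oc sd_law A.
Proof.
rewrite -[f]class_of_rep /= (free_homE Th (rep f)) !delay_homE free_homE.
rewrite [LHS]hom_compE [RHS]hom_compE.
by apply: class_of_eq => u; apply: srel_eq; apply: par_law_nat.
Qed.

Lemma sd_law_unitT (A : setoids) :
  sd_law A \oc munit (T_sd Th) (D_sd A) = fmap D_sd (munit (T_sd Th) A).
Proof.
rewrite [RHS]delay_homE [LHS]hom_compE.
by apply: class_of_eq => u; apply: srel_eq; apply: par_law_eta.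
Qed.

Lemma sd_law_unitD (A : setoids) :
  sd_law A \oc fmap (T_sd Th) (munit D_sd A) = munit D_sd (T_sd Th A).
Proof.
rewrite /= free_homE [LHS]hom_compE.
by apply: class_of_eq => u; apply: srel_eq; apply: par_law_now.
Qed.

Lemma sd_law_multT (A : setoids) :
  sd_law A \oc mmult (T_sd Th) (D_sd A) =
  fmap D_sd (mmult (T_sd Th) A) \oc sd_law (T_sd Th A)
    \oc fmap (T_sd Th) (sd_law A).
Proof.
rewrite /= free_homE delay_homE [X in _ = hom_comp X _]hom_compE.
rewrite [LHS]hom_compE [RHS]hom_compE.
by apply: class_of_eq => u; apply: srel_eq; apply: par_law_mu.
Qed.

Lemma sd_law_multD (A : setoids) :
  sd_law A \oc fmap (T_sd Th) (mmult D_sd A) =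
  mmult D_sd (T_sd Th A) \oc fmap D_sd (sd_law A) \oc sd_law (D_sd A).
Proof.
rewrite /= free_homE delay_homE [X in _ = hom_comp X _]hom_compE.
rewrite [LHS]hom_compE [RHS]hom_compE.
apply: class_of_eq => u.
exact: (@wbisim_conv_eq (free_setoid Th A) _ _ (par_law_djoin u)).
Qed.

End ParLaw.

Theorem theorem7p7 (Th : theory) (nodrop : no_drop_equations Th) :
  exists zeta : distributive_law (T_sd Th) D_sd,
    forall A : setoid,
      exists zeta_rel : forall u v : free_setoid Th (delay_setoid A),
          @srel (free_setoid Th (delay_setoid A)) u v ->
          @srel (delay_setoid (free_setoid Th A))
            (@par_law Th nodrop A u) (@par_law Th nodrop A v),
        dlaw zeta A =
        @class_of (free_setoid Th (delay_setoid A))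
                  (delay_setoid (free_setoid Th A))
                  (@SetoidMap (free_setoid Th (delay_setoid A))
                     (delay_setoid (free_setoid Th A))
                     (@par_law Th nodrop A) zeta_rel).
Proof.
exists (DistributiveLaw (sd_law_nat nodrop) (sd_law_unitT nodrop)
  (sd_law_unitD nodrop) (sd_law_multT nodrop) (sd_law_multD nodrop)).
by move=> A; exists (@par_law_rel Th nodrop A).
Qed.
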